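(* Let $p>5$ be a prime number such that $p-1$ is divisible by $3$. Let $G$, $H\leq G$ and $\lambda\in\operatorname{Lin}(H)$ be the group, subgroup and linear character constructed from $p$ in the context. Then $$\lambda^G=\chi_0+3\sum_{i=1}^{\frac{p-1}{3}}\chi_i,$$ where $\chi_i\in\operatorname{Irr}(G)$ for $i=0,1,\ldots,\frac{p-1}{3}$ and $\chi_i\neq\chi_j$ whenever $i\neq j$. Thus $\eta(\lambda^G)=\frac{p+2}{3}$.
   Context: Character notation: for a finite group $G$, $\operatorname{Irr}(G)$ denotes the set of irreducible complex characters of $G$, and $\operatorname{Lin}(G)$ the set of those of degree $1$. For a subgroup $H$ of $G$ and a character $\lambda$ of $H$, $\lambda^G$ denotes the character of $G$ induced by $\lambda$. For a character $\Gamma$ of $G$, $\eta(\Gamma)$ denotes the number of distinct irreducible constituents of $\Gamma$. Construction. Let $p>5$ be a prime with $3\mid p-1$. Let $F$ be a field of $p$ elements and let $F[x]$ denote the truncated polynomial algebra generated over $F$ by an element $x$ satisfying only $x^4=0$; it is a vector space of dimension $4$ over $F$ with basis $1,x,x^2,x^3$. Let $m$ be an isomorphism of the additive group of $F[x]$ onto a multiplicative group $M$, so that $M$ is elementary abelian of order $p^4$ with generators $m(1),m(x),m(x^2),m(x^3)$. Let $U$ be the subgroup of the unit group $F[x]^{\times}$ generated by $1+x$ and $1+x^2$; it is elementary abelian of order $p^2$. The group $U$ acts on $M$ by $m(y)^u=m(yu)$ for all $y\in F[x]$ and $u\in U$. Let $G$ be the semidirect product of $M$ and $U$ with respect to this action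 ($M$ normal), a group of order $p^6$. Let $H$ be the subgroup $$H=\langle m(1),m(x),m(x^3)\rangle=\{m(a_0+a_1x+a_3x^3)\mid a_0,a_1,a_3\in F\}.$$ Fix a primitive complex $p$-th root of unity $\omega$ and an integer $r>0$ such that $3r\equiv -1 \pmod p$. Let $\lambda\in\operatorname{Lin}(H)$ be given by $$\lambda(m(a_0+a_1x+a_3x^3))=\omega^{ra_0+ra_1+a_3}\quad\text{for } a_0,a_1,a_3\in F.$$ *)

(* Defs.v *)
From HB Require Import structures.
From mathcomp Require Import all_boot all_order all_algebra all_fingroup.
From mathcomp Require Import all_solvable all_field all_character.

Set Implicit Arguments.
Unset Strict Implicit.
Unset Printing Implicit Defensive.

Import GRing.Theory.
Local Open Scope ring_scope.

Definition eta_constt (gT : finGroupType) (G : {group gT}) (Gamma : 'CF(G)) : nat :=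
  #|irr_constt Gamma|.

Section Construction.

Variable p : nat.

(* [{poly %/ h}] falls back to ['X] unless [h] is monic of size > 1, which
   ['X^4] is. *)
Definition truncPoly : predArgType := {poly %/ ('X^4 : {poly 'F_p})}.

HB.instance Definition _ := GRing.ComUnitAlgebra.on truncPoly.
HB.instance Definition _ := Finite.on truncPoly.
HB.instance Definition _ := [finGroupMixin of truncPoly for +%R].

Definition truncX : truncPoly := 'qX.

Lemma truncX_exp4 : truncX ^+ 4 = 0.
Proof.
rewrite -[LHS](rmorphXn (in_qpoly _)); apply/val_inj => /=.
by rewrite mk_monic_Xn Pdiv.RingMonic.rmodpp // monicXn.
Qed.

Lemma unit_1DtruncX : 1 + truncX \is a GRing.unit.
Proof.
apply/unitrPr; exists ((1 - truncX) * (1 + truncX ^+ 2)).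
rewrite mulrA [(1 + _) * _]mulrC -subr_sqr expr1n -subr_sqr expr1n.
by rewrite -exprM truncX_exp4 subr0.
Qed.

Lemma unit_1DtruncX2 : 1 + truncX ^+ 2 \is a GRing.unit.
Proof.
apply/unitrPr; exists (1 - truncX ^+ 2).
by rewrite mulrC -subr_sqr expr1n -exprM truncX_exp4 subr0.
Qed.

Definition groupU : {group {unit truncPoly}} :=
  <<[set FinRing.unit truncPoly unit_1DtruncX;
         FinRing.unit truncPoly unit_1DtruncX2]>>%G.

(* [FinRing]'s ['U] is the action of the units on the additive group by right
   multiplication, y |-> y * u; it is restricted here to [groupU]. *)
Definition actU : groupAction groupU [set: truncPoly] :=
  ('U \ subsetT groupU)%gact.

Definition groupG : {group sdprod_by actU} := [set: sdprod_by actU]%G.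

(* [truncPoly] enters [sdprod_by] as a group for +%R, so [embM] turns sums into
   products. *)
Definition embM : truncPoly -> sdprod_by actU := sdpair1 actU.

(* The %R matters: in group scope [^+] would be an iterated sum. *)
Definition groupH : {group sdprod_by actU} :=
  <<[set embM 1%R; embM truncX; embM (truncX ^+ 3)%R]>>%G.

End Construction.

(* Main.v *)
Require Import Defs.
From HB Require Import structures.
From mathcomp Require Import all_boot all_order all_algebra all_fingroup.
From mathcomp Require Import all_solvable all_field all_character.
From mathcomp Require Import ring.

Set Implicit Arguments.
Unset Strict Implicit.
Unset Printing Implicit Defensive.

Import GRing.Theory.
Local Open Scope ring_scope.

(** Inducing in stages through the abelian normal subgroup M, [lambda] first
    becomes the sum of its p extensions [ext_char t] to M, where t in F_p is
    the exponent of omega at m(x^2) ([Ind_base_sum]).  Everything then rests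
    on how U permutes these extensions.

    Identify the linear characters of M with the functionals on F[x]/(x^4);
    [ext_char t] is the functional f_t with values (r, r, t, 1) on
    1, x, x^2, x^3.  An element y = 1 + a x + c x^2 + d x^3 carries f_s to f_t
    exactly when a = t - s, c = - s a and d = - r a - s c, so there is a single
    candidate y for each pair (s, t).  On the other hand U consists of the y
    with 3 d = 3 a c + a - a^3 ([groupU_on_curve], [groupU_coef]).  Substituting
    and using 3 r = -1, this equation becomes s^3 = t^3 ([card_twist]).

    Mackey's formula for the semidirect product turns this count into
    <Ind f_s, Ind f_t> = 1 if s^3 = t^3 and 0 otherwise ([cfdot_Ind_ext_char]).
    Hence each Ind f_t is irreducible, and two of them coincide exactly when
    the cubes of their parameters do.  As 3 divides p - 1, cubing is
    three-to-one on F_p^*; so t = 0 contributes one constituent of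
    multiplicity 1, and the nonzero t contribute (p - 1)/3 constituents, each
    of multiplicity 3, indexed by the first (p - 1)/3 powers of a generator
    of F_p^*. *)

(** * Coordinates in the truncated polynomial algebra *)

Section Trunc.
Variable p : nat.
Implicit Types y z : truncPoly p.

Definition tcoef y (i : nat) : 'F_p := (val y)`_i.

Lemma tcoefD y z i : tcoef (y + z) i = tcoef y i + tcoef z i.
Proof. by rewrite /tcoef raddfD coefD. Qed.

Lemma tcoefZ (a : 'F_p) y i : tcoef (a *: y) i = a * tcoef y i.
Proof. by rewrite /tcoef /= coefZ. Qed.

Lemma tcoef_in_qpoly (q : {poly 'F_p}) i : (i < 4)%N ->
  tcoef (in_qpoly 'X^4 q) i = q`_i.
Proof.
move=> i_lt4; rewrite /tcoef /= mk_monic_Xn /=.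
rewrite [in RHS](Pdiv.RingMonic.rdivp_eq (monicXn _ 4) q) coefD coefMXn.
by rewrite i_lt4 add0r.
Qed.

Lemma tcoefM y z i : (i < 4)%N ->
  tcoef (y * z) i = \sum_(j < i.+1) tcoef y j * tcoef z (i - j).
Proof.
by move=> i_lt4; rewrite [y * z]/(in_qpoly _ _) tcoef_in_qpoly // coefM.
Qed.

Lemma tcoefM0 y z : tcoef (y * z) 0 = tcoef y 0 * tcoef z 0.
Proof. by rewrite tcoefM // big_ord1. Qed.

Lemma tcoefM1 y z :
  tcoef (y * z) 1 = tcoef y 0 * tcoef z 1 + tcoef y 1 * tcoef z 0.
Proof. by rewrite tcoefM // !big_ord_recl big_ord0 addr0. Qed.

Lemma tcoefM2 y z : tcoef (y * z) 2
  = tcoef y 0 * tcoef z 2 + tcoef y 1 * tcoef z 1 + tcoef y 2 * tcoef z 0.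
Proof. by rewrite tcoefM // !big_ord_recl big_ord0 addr0 !addrA. Qed.

Lemma tcoefM3 y z : tcoef (y * z) 3
  = tcoef y 0 * tcoef z 3 + tcoef y 1 * tcoef z 2 + tcoef y 2 * tcoef z 1
    + tcoef y 3 * tcoef z 0.
Proof. by rewrite tcoefM // !big_ord_recl big_ord0 addr0 !addrA. Qed.

Lemma tcoef1 i : tcoef 1 i = (i == 0)%N%:R.
Proof. by rewrite /tcoef /= coefC; case: i. Qed.

Lemma tcoefXn n i : (i < 4)%N -> tcoef (truncX p ^+ n) i = (i == n)%:R.
Proof.
move=> i_lt4; rewrite -[_ ^+ n](rmorphXn (in_qpoly _)).
by rewrite tcoef_in_qpoly // coefXn.
Qed.

Lemma truncP y z : (forall i, (i < 4)%N -> tcoef y i = tcoef z i) -> y = z.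
Proof.
move=> eq_yz; apply/val_inj/polyP=> i.
have [/eq_yz // | i_ge4] := ltnP i 4.
by rewrite !big_coef_npoly // mk_monic_Xn size_polyXn.
Qed.

Lemma tcoef0 i : tcoef 0 i = 0.
Proof. by rewrite /tcoef coef0. Qed.

Lemma truncE y : y = tcoef y 0 *: 1 + tcoef y 1 *: truncX p
   + tcoef y 2 *: truncX p ^+ 2 + tcoef y 3 *: truncX p ^+ 3.
Proof.
rewrite -[truncX p in X in _ + X + _ + _]expr1 -(expr0 (truncX p)).
by apply: truncP => -[|[|[|[|//]]]] _; rewrite !(tcoefD, tcoefZ) !tcoefXn //=;
  rewrite !(mulr0, mulr1, addr0, add0r).
Qed.

End Trunc.

(** * The unit group U as a hypersurface *)

Section UnitGroup.
Variable p : nat.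
Implicit Types (y z : truncPoly p) (u : {unit truncPoly p}).

(** For y with constant term 1, the coefficients of x and x^3 in log y are y1
    and y3 - y1 y2 + y1^3 / 3.  The equation below says that the second is a
    third of the first, as it is for y = 1 + x and y = 1 + x^2; it is written
    without denominators. *)
Definition on_curve y :=
  (tcoef y 0 == 1) && (3 * tcoef y 3 ==
    3 * (tcoef y 1 * tcoef y 2) + tcoef y 1 - tcoef y 1 ^+ 3).

(** The logarithm turns products into sums, and the equation is linear in
    log y. *)
Lemma on_curveM y z : on_curve y -> on_curve z -> on_curve (y * z).
Proof.
rewrite /on_curve !(tcoefM0, tcoefM1, tcoefM2, tcoefM3).
case/andP=> /eqP-> /eqP e1 /andP[/eqP-> /eqP e2].
rewrite !mul1r eqxx !mulr1 /= !mulrDr e1 e2; apply/eqP; ring.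
Qed.

Lemma on_curve1 : on_curve 1.
Proof.
by rewrite /on_curve !tcoef1 /= !(mulr0, addr0, expr0n, subr0) /= eqxx.
Qed.

Lemma on_curve_1DtruncX : on_curve (1 + truncX p).
Proof.
rewrite /on_curve !tcoefD !tcoef1 -[truncX p]expr1 !tcoefXn //=.
by rewrite !(mulr0, addr0, add0r, expr1n, subrr) !eqxx.
Qed.

Lemma on_curve_1DtruncX2 : on_curve (1 + truncX p ^+ 2).
Proof.
rewrite /on_curve !tcoefD !tcoef1 !tcoefXn //=.
by rewrite !(mul0r, mulr0, addr0, add0r, expr0n) /= oppr0 !eqxx.
Qed.

Lemma groupU_on_curve u : u \in groupU p -> on_curve (val u).
Proof.
pose K := [set v : {unit truncPoly p} | on_curve (val v)].
have gK : group_set K.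
  apply/group_setP; split=> [|v w]; first by rewrite inE on_curve1.
  by rewrite !inE; apply: on_curveM.
suff sUK : (groupU p \subset Group gK)%g by move/(subsetP sUK); rewrite inE.
rewrite gen_subG; apply/subsetP=> v /set2P[]->; rewrite inE /=.
  exact: on_curve_1DtruncX.
exact: on_curve_1DtruncX2.
Qed.

(** In (1 + x)^m (1 + x^2)^n the coefficient of x is m, and n shifts that of
    x^2, so these two coefficients are arbitrary; the equation then determines
    the third. *)
Lemma groupU_coef (a c : 'F_p) : exists2 u, u \in groupU p &
  (tcoef (val u) 1 = a) /\ (tcoef (val u) 2 = c).
Proof.
pose v := FinRing.unit (truncPoly p) (unit_1DtruncX p).
pose w := FinRing.unit (truncPoly p) (unit_1DtruncX2 p).
have Uv n : (v ^+ n)%g \in groupU p by rewrite groupX // mem_gen // !inE eqxx.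
have Uw n : (w ^+ n)%g \in groupU p.
  by rewrite groupX // mem_gen // !inE eqxx orbT.
have c0 u : u \in groupU p -> tcoef (val u) 0 = 1.
  by move/groupU_on_curve/andP=> [/eqP].
have Uv1 : v \in groupU p by rewrite -[v]expg1.
have Uw1 : w \in groupU p by rewrite -[w]expg1.
have v1 n : tcoef (val (v ^+ n)%g) 1 = n%:R.
  elim: n => [|n IHn]; first by rewrite tcoef1.
  rewrite expgS FinRing.val_unitM tcoefM1 IHn !c0 //.
  by rewrite tcoefD tcoef1 -[truncX p]expr1 tcoefXn //= add0r !mul1r natr1.
have w12 n : tcoef (val (w ^+ n)%g) 1 = 0 /\ tcoef (val (w ^+ n)%g) 2 = n%:R.
  elim: n => [|n [IHn1 IHn2]]; first by rewrite !tcoef1.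
  rewrite expgS FinRing.val_unitM tcoefM1 tcoefM2 IHn1 IHn2 !c0 //.
  rewrite !tcoefD !tcoef1 !tcoefXn //=.
  by rewrite !(mulr0, mul0r, addr0, add0r, mulr1, mul1r) natr1.
pose b : 'F_p := c - tcoef (val (v ^+ a)%g) 2.
exists (v ^+ a * w ^+ b)%g; first exact: groupM.
rewrite FinRing.val_unitM tcoefM1 tcoefM2 !c0 //.
have [-> ->] := w12 b.
by rewrite v1 !(mulr0, mulr1, mul1r, add0r, addr0) !natr_Zp subrK.
Qed.

End UnitGroup.

(** * The action of U on the functionals extending lambda *)

Section Functional.
Variables (p : nat) (r : 'F_p).
Hypothesis rP : 3 * r = -1.
Implicit Types (y z : truncPoly p) (u : {unit truncPoly p}) (s t : 'F_p).

(** The exponent of omega in the extension of [lambda] with parameter t. *)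
Definition extf t y : 'F_p :=
  r * tcoef y 0 + r * tcoef y 1 + t * tcoef y 2 + tcoef y 3.

Lemma extfD t y z : extf t (y + z) = extf t y + extf t z.
Proof. rewrite /extf !tcoefD; ring. Qed.

Lemma nz3 : (3 : 'F_p) != 0.
Proof.
by apply: contra_eq_neq rP => ->; rewrite mul0r eq_sym oppr_eq0 oner_eq0.
Qed.

(** Comparing the two functionals at z = x^2, x and 1, in this order, gives the
    three coefficients of y one after the other; at z = x^3 both take the
    value 1. *)
Lemma extf_twistP s t y : tcoef y 0 = 1 ->
  (forall z, extf s (z * y) = extf t z) <->
  [/\ tcoef y 1 = t - s, tcoef y 2 = - (s * tcoef y 1)
    & tcoef y 3 = - (r * tcoef y 1) - s * tcoef y 2].
Proof.
move=> y0; rewrite /extf; split=> [tw|[y1 y2 y3] z].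
  have cX (n i : nat) : (i < 4)%N -> tcoef (truncX p ^+ n) i = (i == n)%:R.
    exact: tcoefXn.
  have := tw (truncX p ^+ 2); have := tw (truncX p ^+ 1).
  have := tw (truncX p ^+ 0).
  rewrite !(tcoefM0, tcoefM1, tcoefM2, tcoefM3) !cX // y0 /=.
  rewrite !(mulr0, mul0r, mulr1, mul1r, addr0, add0r) => e0 e1 e2.
  split.
  - by rewrite -e2; ring.
  - by apply: (addrI (r + s * tcoef y 1)); rewrite e1; ring.
  - by apply: (addrI (r + r * tcoef y 1 + s * tcoef y 2)); rewrite e0; ring.
rewrite !(tcoefM0, tcoefM1, tcoefM2, tcoefM3) y0 y3 y2 y1; ring.
Qed.

(** At most one unit carries f_s to f_t, by [extf_twistP].  On substituting its
    coefficients, the equation of U becomes a^3 + 3 s a^2 + 3 s^2 a = 0 with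
    a = t - s, that is (s + a)^3 = s^3.  This is where 3 r = -1 enters. *)
Lemma card_twist s t :
  #|[set u in groupU p | [forall z, extf s (z * val u) == extf t z]]|
    = (s ^+ 3 == t ^+ 3).
Proof.
pose a := t - s; pose c := - (s * a); pose d := - (r * a) - s * c.
have curve_d : (3 * d == 3 * (a * c) + a - a ^+ 3) = (s ^+ 3 == t ^+ 3).
  have ->: 3 * d = - ((3 * r) * a) - 3 * s * c by rewrite /d; ring.
  rewrite rP -subr_eq0 -[RHS]subr_eq0 -[RHS]oppr_eq0; congr (_ == 0).
  by rewrite /c /a; ring.
have coefU u : u \in groupU p -> tcoef (val u) 0 = 1 /\ 3 * tcoef (val u) 3 =
    3 * (tcoef (val u) 1 * tcoef (val u) 2)
      + tcoef (val u) 1 - tcoef (val u) 1 ^+ 3.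
  by move/groupU_on_curve/andP=> [/eqP-> /eqP->].
have memE u : u \in groupU p -> [forall z, extf s (z * val u) == extf t z] ->
    [/\ tcoef (val u) 1 = a, tcoef (val u) 2 = c & tcoef (val u) 3 = d].
  case/coefU=> u0 _ /eqfunP tw.
  have [e1 e2 e3] := (extf_twistP s t u0).1 tw.
  by rewrite /d /c; split; rewrite ?e3 ?e2 ?e1.
have [e|ne] := boolP (s ^+ 3 == t ^+ 3); last first.
  apply/eqP; rewrite cards_eq0; apply/eqP/setP=> u; rewrite !inE.
  apply/negP=> /andP[Uu tw]; case/negP: ne; rewrite -curve_d.
  by have [<- <- <-] := memE u Uu tw; apply/eqP; case: (coefU u Uu).
have [u0 Uu0 [u1 u2]] := groupU_coef a c.
have [u00 u03] := coefU u0 Uu0.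
have u3: tcoef (val u0) 3 = d.
  by apply: (mulfI nz3); rewrite u03 u1 u2; apply/esym/eqP; rewrite curve_d.
apply/eqP/cards1P; exists u0; apply/setP=> u; rewrite !inE.
apply/andP/eqP=> [[Uu tw] | ->].
  apply/val_inj/truncP.
  have [v0 _] := coefU u Uu; have [v1 v2 v3] := memE u Uu tw.
  by case=> [|[|[|[|//]]]] _; rewrite ?v0 ?v1 ?v2 ?v3.
by split=> //; apply/eqfunP/extf_twistP; rewrite ?u1 ?u2 ?u3.
Qed.

End Functional.

(** * Inner products of induced characters in a semidirect product *)

Section Mackey.
Variables (gT : finGroupType) (G M K : {group gT}).
Hypothesis defG : (M ><| K)%g = G.

(** By Frobenius reciprocity the left-hand side is <phi, Res Ind psi>, and the
    restriction of Ind psi to M is the sum of the K-conjugates of psi. *)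
Lemma cfdot_Ind_sdprod (phi psi : 'CF(M)) : phi \in irr M -> psi \in irr M ->
  '['Ind[G] phi, 'Ind[G] psi]
    = #|[set w in K | phi == (psi ^ w^-1%g)%CF]|%:R.
Proof.
move=> irr_phi irr_psi.
have [/andP[sMG nMG] sKG _ nMK _] := sdprod_context defG.
have ResInd : 'Res[M] ('Ind[G] psi) = \sum_(w in K) (psi ^ w^-1%g)%CF.
  apply/cfun_inP=> x Mx; rewrite cfResE // (cfIndEsdprod _ _ defG) sum_cfunE.
  apply: eq_bigr => w Kw.
  by rewrite cfConjgE ?invgK // groupV (subsetP nMK).
rewrite -cfdot_Res_r ResInd cfdot_sumr -sum1dep_card natr_sum big_mkcondr /=.
have /orthonormalP[_ dotE] := irr_orthonormal M.
apply: eq_bigr => w Kw; rewrite dotE //; first by case: eqP.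
exact: cfConjg_irr.
Qed.

End Mackey.

(** * The extensions of lambda to M *)

Section RootOfUnity.
Variables (p : nat) (omega : algC).
Hypotheses (p_prime : prime p) (omega_prim : p.-primitive_root omega).

Definition zeta (a : 'F_p) : algC := omega ^+ a.

Lemma zeta_nat n : omega ^+ n = zeta n%:R.
Proof. by rewrite /zeta val_Fp_nat // prim_expr_mod. Qed.

Lemma zetaD a b : zeta (a + b) = zeta a * zeta b.
Proof.
by rewrite -[a]natr_Zp -[b]natr_Zp -natrD -!zeta_nat exprD.
Qed.

Lemma zeta0 : zeta 0 = 1.
Proof. by rewrite -[0]/(0%:R) -zeta_nat. Qed.

Lemma zetaX a n : zeta a ^+ n = zeta (a *+ n).
Proof.
by elim: n => [|n IHn]; rewrite ?zeta0 // exprS IHn mulrS zetaD.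
Qed.

Lemma zeta_inj : injective zeta.
Proof.
move=> a b /eqP; rewrite (eq_prim_root_expr omega_prim) => /eqP eq_ab.
by rewrite -[a]natr_Zp -[b]natr_Zp; apply/val_inj; rewrite /= !val_Fp_nat.
Qed.

End RootOfUnity.

Section Characters.
Variables (p : nat) (omega : algC) (r : 'F_p).
Hypotheses (p_prime : prime p) (omega_prim : p.-primitive_root omega).
Hypothesis rP : 3 * r = -1.
Implicit Types (y z : truncPoly p) (s t : 'F_p).

Local Notation T := (truncPoly p).
Local Notation gT := (sdprod_by (actU p)).
Local Notation zeta := (zeta omega).

(** The normal subgroup M of G. *)
Definition baseM : {group gT} := (sdpair1 (actU p) @* [set: T])%G.

Lemma embM_base y : embM y \in baseM.
Proof. by rewrite mem_morphim // inE. Qed.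

Lemma baseMP g : reflect (exists y, g = embM y) (g \in baseM).
Proof.
by apply: (iffP morphimP) => [[y _ _ ->]|[y ->]]; exists y => //; rewrite inE.
Qed.

Lemma embMD y z : embM (y + z) = (embM y * embM z)%g.
Proof. by rewrite /embM -sdpair1_morphM ?inE. Qed.

Lemma embMMn y n : embM (y *+ n) = (embM y ^+ n)%g.
Proof.
elim: n => [|n IHn]; first by rewrite mulr0n expg0 [embM 0]morph1.
by rewrite mulrS expgS embMD IHn.
Qed.

Lemma baseM_abelian : abelian baseM.
Proof.
apply/centsP=> _ /baseMP[y ->] _ /baseMP[z ->].
by rewrite /commute -!embMD addrC.
Qed.

Definition logM g : T := invm (injm_sdpair1 (actU p)) g.

Lemma embMK : cancel (@embM p) logM.
Proof. by move=> y; rewrite /logM /embM invmE ?inE. Qed.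

Lemma ext_char_subproof t :
  mx_repr baseM (fun g => (zeta (extf r t (logM g)))%:M : 'M[algC]_1).
Proof.
split=> [|_ _ /baseMP[y ->] /baseMP[z ->]].
  have ->: 1%g = embM (0 : T) by rewrite [embM 0]morph1.
  by rewrite embMK /extf !tcoef0 !mulr0 !addr0 zeta0.
by rewrite -embMD !embMK extfD zetaD // scalar_mxM.
Qed.

Definition ext_char t := cfRepr (MxRepresentation (ext_char_subproof t)).

Lemma ext_charE t y : ext_char t (embM y) = zeta (extf r t y).
Proof. by rewrite cfunE embM_base /= embMK mxtrace_scalar. Qed.

Lemma ext_char_lin t : ext_char t \is a linear_char.
Proof.
rewrite qualifE /= cfRepr_char /=.
have ->: 1%g = embM (0 : T) by rewrite [embM 0]morph1.
by rewrite ext_charE /extf !tcoef0 !mulr0 !addr0 zeta0.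
Qed.

Lemma ext_char_irr t : ext_char t \in irr baseM.
Proof. exact/lin_char_irr/ext_char_lin. Qed.

Lemma cfun_baseMP (phi chi : 'CF(baseM)) :
  phi = chi <-> forall y, phi (embM y) = chi (embM y).
Proof.
split=> [-> // | eq_y]; apply/cfun_inP=> _ /baseMP[y ->]; exact: eq_y.
Qed.

(** The copy of U in G, a complement of M. *)
Definition complU : {group gT} := (sdpair2 (actU p) @* groupU p)%G.

Lemma sdprodG : (baseM ><| complU)%g = groupG p.
Proof. exact: sdprod_sdpair. Qed.

(** Conjugation by u turns f_t into z |-> f_t(z u), so Mackey's count is the one
    of [card_twist]. *)
Lemma cfdot_Ind_ext_char s t :
  '['Ind[groupG p] (ext_char s), 'Ind[groupG p] (ext_char t)]
    = (s ^+ 3 == t ^+ 3)%:R.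
Proof.
rewrite (cfdot_Ind_sdprod sdprodG) ?ext_char_irr //; congr _%:R.
(* The units counted here carry f_t to f_s. *)
rewrite eq_sym -(card_twist rP).
rewrite -(card_in_imset (f := sdpair2 (actU p))); last first.
  move=> u v; rewrite !inE => /andP[Uu _] /andP[Uv _].
  exact: (injmP (injm_sdpair2 (actU p))).
apply: eq_card => g.
have act_emb u z : u \in groupU p ->
    embM (z * val u) = (embM z ^ sdpair2 (actU p) u)%g.
  by move=> Uu; rewrite /embM -sdpair_act ?inE.
have nM g' : g' \in complU -> g' \in 'N(baseM)%g.
  by have [_ _ _ /subsetP nMU _] := sdprod_context sdprodG; apply: nMU.
rewrite inE; apply/andP/imsetP=> [[/morphimP[u _ Uu ->] /eqP eq_st]|[u]].
  exists u => //; rewrite inE Uu /=; apply/forallP=> z.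
  have Mu := mem_morphim (sdpair2 (actU p)) Uu Uu.
  apply/eqP; apply: (zeta_inj p_prime omega_prim).
  rewrite -!ext_charE // eq_st cfConjgE ?groupV ?nM // invgK.
  by rewrite -act_emb.
rewrite inE => /andP[Uu /eqfunP tw] ->.
have Mu := mem_morphim (sdpair2 (actU p)) Uu Uu; split=> //.
apply/eqP/cfun_baseMP=> z; rewrite cfConjgE ?groupV ?nM // invgK -act_emb //.
by rewrite !ext_charE tw.
Qed.

Lemma ext_char_inj : injective ext_char.
Proof.
move=> s t /cfun_baseMP/(_ (truncX p ^+ 2)).
rewrite !ext_charE => /(zeta_inj p_prime omega_prim).
by rewrite /extf !tcoefXn //= !(mulr0, mulr1, add0r, addr0).
Qed.

Lemma groupHP g :
  reflect (exists2 y, tcoef y 2 = 0 & g = embM y) (g \in groupH p).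
Proof.
pose K := [set embM y | y in [pred y : T | tcoef y 2 == 0]].
have memK y : tcoef y 2 = 0 -> embM y \in K.
  by move=> y2; apply/imsetP; exists y; rewrite // inE y2.
have gK : group_set K.
  apply/group_setP; split=> [|_ _ /imsetP[y y2 ->] /imsetP[z z2 ->]].
    by rewrite -(morph1 (sdpair1 (actU p))); apply: memK; rewrite tcoef0.
  rewrite -embMD; apply: memK.
  by rewrite tcoefD (eqP y2) (eqP z2) addr0.
apply: (iffP idP) => [Hg | [y y2 ->]].
  have sHK : (groupH p \subset Group gK)%g.
    rewrite gen_subG; apply/subsetP=> h; rewrite !inE => /orP[/orP[]|] /eqP->;
      apply: memK; first by rewrite tcoef1.
    - by rewrite -[truncX p]expr1 tcoefXn.
    - by rewrite tcoefXn.
  by have /imsetP[y /eqP y2 ->] := subsetP sHK g Hg; exists y.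
have memHZ (a : 'F_p) z : embM z \in groupH p -> embM (a *: z) \in groupH p.
  by move=> Hz; rewrite -[a]natr_Zp scaler_nat embMMn groupX.
rewrite [y]truncE y2 scale0r addr0 !embMD !groupM ?memHZ // mem_gen //.
- by rewrite !inE eqxx.
- by rewrite !inE eqxx orbT.
- by rewrite !inE eqxx orbT.
Qed.

Lemma groupH_sub : (groupH p \subset baseM)%g.
Proof. by apply/subsetP=> _ /groupHP[y _ ->]; apply: embM_base. Qed.

Section Induced.
Variable lambda : 'CF(groupH p).
Hypothesis lambda_lin : lambda \is a linear_char.
Hypothesis lambdaE : forall y, tcoef y 2 = 0 ->
  lambda (embM y) = zeta (extf r 0 y).

(** A linear character of M with restriction lambda is determined by its value
    at m(x^2), which is a p-th root of unity omega^t as M has exponent p. *)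
Lemma Res_ext_charP (chi : 'CF(baseM)) : chi \is a linear_char ->
  'Res chi = lambda <-> exists t, ext_char t = chi.
Proof.
move=> chi_lin; split=> [resE | [t <-]]; last first.
  apply/cfun_inP=> _ /groupHP[y y2 ->].
  rewrite cfResE ?groupH_sub //; last by apply/groupHP; exists y.
  by rewrite ext_charE lambdaE // /extf y2 !mulr0.
have chiD y z : chi (embM (y + z)) = chi (embM y) * chi (embM z).
  by rewrite embMD lin_charM ?embM_base.
have chiMn y n : chi (embM (y *+ n)) = chi (embM y) ^+ n.
  by rewrite embMMn lin_charX ?embM_base.
have [t chiX2] : exists t, chi (embM (truncX p ^+ 2)) = zeta t.
  have: chi (embM (truncX p ^+ 2)) ^+ p = 1.
    rewrite -chiMn -scaler_nat pchar_Fp_0 // scale0r.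
    by rewrite [embM 0]morph1 lin_char1.
  by case/(prim_rootP omega_prim) => i ->; exists i%:R; rewrite -zeta_nat.
exists t; apply/cfun_baseMP => y.
pose y' := y + (- tcoef y 2) *: truncX p ^+ 2.
have y'2 : tcoef y' 2 = 0 by rewrite tcoefD tcoefZ tcoefXn // mulr1 subrr.
have chi_y' : chi (embM y') = zeta (extf r 0 y').
  have Hy' : embM y' \in groupH p by apply/groupHP; exists y'.
  by rewrite -lambdaE // -resE cfResE ?groupH_sub.
have ->: y = y' + truncX p ^+ 2 *+ tcoef y 2.
  by rewrite /y' -scaler_nat natr_Zp scaleNr subrK.
rewrite chiD chiMn chiX2 zetaX // chi_y' -zetaD // ext_charE; congr zeta.
rewrite extfD [extf r t y']/extf /extf y'2 !mulr0 -!addrA; congr (_ + (_ + _)).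
rewrite -scaler_nat natr_Zp !tcoefZ !tcoefXn //= !(mulr0, addr0, mulr1, add0r).
by rewrite -[t *+ _]mulr_natr natr_Zp.
Qed.

(** Each irreducible character of the abelian group M is linear, so by
    reciprocity its multiplicity in Ind lambda is 1 if it extends lambda and 0
    otherwise. *)
Lemma Ind_base_sum : 'Ind[baseM] lambda = \sum_t ext_char t.
Proof.
have /orthonormalP[_ dotM] := irr_orthonormal baseM.
have /orthonormalP[_ dotH] := irr_orthonormal (groupH p).
rewrite [LHS]cfun_sum_cfdot [RHS]cfun_sum_cfdot; apply: eq_bigr => i _.
have chi_lin : 'chi_i \is a linear_char by apply/char_abelianP/baseM_abelian.
congr (_ *: _); rewrite -cfdot_Res_r cfdot_suml dotH; last 2 first.
- exact: lin_char_irr.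
- exact/lin_char_irr/cfRes_lin_char.
rewrite (eq_bigr (fun t => (ext_char t == 'chi_i)%:R)) => [|t _]; last first.
  by rewrite dotM ?ext_char_irr ?mem_irr.
have [e|ne] := eqVneq lambda ('Res 'chi_i); last first.
  rewrite big1 // => t _; case: eqP => // e; case/eqP: ne; apply/esym.
  by apply/Res_ext_charP => //; exists t.
have [//|t psi_t] := (Res_ext_charP chi_lin).1 _.
rewrite (bigD1 t) //= psi_t eqxx big1 ?addr0 // => s ne_st.
case: eqP => // psi_s; case/eqP: ne_st; apply: ext_char_inj.
by rewrite psi_s psi_t.
Qed.

Lemma Ind_sum : 'Ind[groupG p] lambda = \sum_t 'Ind[groupG p] (ext_char t).
Proof.
by rewrite -(cfIndInd _ (subsetT baseM) groupH_sub) Ind_base_sum linear_sum.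
Qed.

End Induced.
End Characters.

(** * Counting the constituents *)

Lemma Fp_prim_root p : prime p -> exists g : 'F_p, p.-1.-primitive_root g.
Proof.
move=> p_pr; pose rs := enum [set~ 0 : 'F_p].
have szrs : size rs = p.-1 by rewrite -cardE cardsC1 card_Fp.
have : has p.-1.-primitive_root rs.
  apply: has_prim_root; rewrite ?enum_uniq ?szrs //.
    by rewrite -subn1 subn_gt0 prime_gt1.
  apply/allP=> x; rewrite mem_enum !inE => nz_x; rewrite unity_rootE.
  have xp : x ^+ p = x by have := expf_card x; rewrite card_Fp.
  by rewrite -(inj_eq (mulfI nz_x)) mulr1 -exprS prednK ?prime_gt0 // xp.
by case/hasP=> g _; exists g.
Qed.

(** Letting the exponents start at 1 leaves the index 0 free for t = 0. *)
Lemma sum_Fp_prim_root (V : nmodType) p (g : 'F_p) (X : 'F_p -> V) :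
    prime p -> p.-1.-primitive_root g ->
  \sum_t X t = X 0 + \sum_(1 <= i < p.-1.+1) X (g ^+ i).
Proof.
move=> p_pr g_prim; have nz_g : g != 0.
  by rewrite (prim_root_eq0 g_prim) -lt0n (prim_order_gt0 g_prim).
rewrite (bigD1 0) //=; congr (_ + _).
rewrite big_add1 /= big_mkord.
pose h (i : 'I_p.-1) := g ^+ i.+1.
have inj_h : injective h.
  move=> i j; rewrite /h !exprS => /(mulfI nz_g)/eqP.
  rewrite (eq_prim_root_expr g_prim) !modn_small // => /eqP; exact: val_inj.
rewrite -(big_imset X (h := h) (A := predT)) /=; last first.
  by move=> i j _ _; apply: inj_h.
have <- : [set~ 0] = h @: 'I_p.-1.
  apply/esym/eqP; rewrite eqEcard; apply/andP; split.
    by apply/subsetP=> _ /imsetP[i _ ->]; rewrite !inE expf_neq0.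
  by rewrite cardsC1 card_Fp // card_imset // card_ord.
by apply: eq_bigl => t; rewrite !inE.
Qed.

Lemma sum_periodic (V : nmodType) (f : nat -> V) n k :
    (forall i, f (i + n)%N = f i) ->
  \sum_(1 <= i < (n * k).+1) f i = (\sum_(1 <= i < n.+1) f i) *+ k.
Proof.
move=> f_per; elim: k => [|k IHk]; first by rewrite muln0 big_geq.
have -> : (n * k.+1).+1 = ((n * k).+1 + n)%N by rewrite mulnS addnC.
rewrite (big_cat_nat (n := (1 + n)%N)) ?ltnS ?leq_addl ?leq_addr //=.
rewrite mulrS -IHk; congr (_ + _); rewrite big_addn addnK.
exact: eq_bigr.
Qed.

Lemma eta_constt_sum (gT : finGroupType) (G : {group gT}) n
    (chi : nat -> 'CF(G)) (m : nat -> nat) :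
    (forall i, (i < n)%N -> chi i \in irr G) ->
    (forall i j, (i < n)%N -> (j < n)%N -> chi i = chi j -> i = j) ->
    (forall i, (i < n)%N -> (0 < m i)%N) ->
  eta_constt (\sum_(0 <= i < n) (m i)%:R *: chi i) = n.
Proof.
move=> chi_irr chi_inj m_gt0; pose c (i : 'I_n) := cfIirr (chi i).
have cE i : 'chi_(c i) = chi i by rewrite cfIirrE ?chi_irr.
have c_inj : injective c.
  by move=> i j /(congr1 (fun k => 'chi_k)); rewrite !cE => /chi_inj/val_inj->.
rewrite /eta_constt -[RHS]card_ord -(card_imset _ c_inj); apply: eq_card => k.
rewrite irr_consttE big_mkord cfdot_suml.
rewrite (eq_bigr (fun i : 'I_n => (m i * (c i == k))%:R)) => [|i _]; last first.
  by rewrite cfdotZl -cE cfdot_irr natrM.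
rewrite -natr_sum Num.Theory.pnatr_eq0 sum_nat_eq0 negb_forall /=.
apply/existsP/imsetP=> [[i]|[i _ ->]]; last first.
  by exists i; rewrite eqxx muln1 -lt0n m_gt0.
by rewrite muln_eq0 negb_or eqb0 negbK => /andP[_ /eqP <-]; exists i.
Qed.

Theorem theorem4p23 (p : nat) (p_prime : prime p) (p_gt5 : (5 < p)%N)
    (dvd3p1 : (3 %| p - 1)%N)
    (omega : algC) (omega_prim : p.-primitive_root omega)
    (r : nat) (r_gt0 : (0 < r)%N) (rP : (3 * r%:Z = -1 %[mod p%:Z])%Z)
    (lambda : 'CF(groupH p)) (lambda_lin : lambda \is a linear_char)
    (lambdaE : forall a0 a1 a3 : 'F_p,
       lambda (embM (a0 *: 1 + a1 *: truncX p + a3 *: truncX p ^+ 3))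
         = omega ^+ (r * a0 + r * a1 + a3)) :
  (exists chi : nat -> 'CF(groupG p),
     [/\ forall i, (i <= (p - 1) %/ 3)%N -> chi i \in irr (groupG p),
         forall i j, (i <= (p - 1) %/ 3)%N -> (j <= (p - 1) %/ 3)%N ->
           i <> j -> chi i <> chi j
       & 'Ind[groupG p] lambda
           = chi 0%N + 3%:R *: \sum_(1 <= i < ((p - 1) %/ 3).+1) chi i])
  /\ eta_constt ('Ind[groupG p] lambda) = ((p + 2) %/ 3)%N.
Proof.
pose q : 'F_p := r%:R.
have qP : 3 * q = -1.
  have /eqP := rP; rewrite eqz_mod_dvd opprK -[1]/(Posz 1) -PoszM -PoszD.
  rewrite dvdzE /= (dvdn_pcharf (pchar_Fp p_prime)) natrD natrM addr_eq0.
  by move/eqP.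
have lambdaE' y : tcoef y 2 = 0 -> lambda (embM y) = zeta omega (extf q 0 y).
  move=> y2; rewrite {1}[y]truncE y2 scale0r addr0 lambdaE.
  rewrite (zeta_nat p_prime omega_prim).
  by congr zeta; rewrite /extf y2 mulr0 addr0 !natrD !natrM !natr_Zp.
set n := ((p - 1) %/ 3)%N.
have p1E : p.-1 = (n * 3)%N by rewrite /n divnK ?dvd3p1 // subn1.
have [g g_prim] := Fp_prim_root p_prime.
have nz_g : g != 0.
  by rewrite (prim_root_eq0 g_prim) -lt0n (prim_order_gt0 g_prim).
pose X t := 'Ind[groupG p] (ext_char q p_prime omega_prim t).
have dotX s t : '[X s, X t] = (s ^+ 3 == t ^+ 3)%:R.
  by apply: cfdot_Ind_ext_char.
have X_irr t : X t \in irr (groupG p).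
  by rewrite irrEchar dotX eqxx cfInd_char ?lin_charW ?ext_char_lin /=.
have X_eq s t : (X s == X t) = (s ^+ 3 == t ^+ 3).
  have /orthonormalP[_ dotG] := irr_orthonormal (groupG p).
  have := dotX s t; rewrite dotG // => /eqP; rewrite Num.Theory.eqr_nat.
  by case: (X s == X t); case: (_ ^+ 3 == _).
(* The powers of g with exponents 1, ..., n represent the nonzero elements of
   F_p up to equality of cubes, since the cube of g has order n. *)
pose chi i := X (if i is 0%N then 0 else g ^+ i).
have chi_inj i j : (i <= n)%N -> (j <= n)%N -> chi i = chi j -> i = j.
  have nz_gX k : (0 == (g ^+ k) ^+ 3) = false.
    by rewrite eq_sym !expf_eq0 (negPf nz_g) /= !andbF.
  move=> le_in le_jn /eqP; rewrite /chi X_eq.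
  case: i j le_in le_jn => [|i] [|j] lt_in lt_jn //;
    rewrite ?[0 ^+ 3]expr0n /= ?nz_gX //.
    by rewrite eq_sym nz_gX.
  rewrite (exprS g i) (exprS g j) !exprMn.
  rewrite (inj_eq (mulfI (expf_neq0 3 nz_g))) -!exprM.
  rewrite (eq_prim_root_expr g_prim) p1E -!muln_modl !modn_small //.
  by rewrite eqn_pmul2r // => /eqP->.
have indE : 'Ind[groupG p] lambda =
    chi 0%N + 3%:R *: \sum_(1 <= i < n.+1) chi i.
  rewrite (Ind_sum p_prime omega_prim lambda_lin lambdaE') -/X.
  rewrite (sum_Fp_prim_root X p_prime g_prim); congr (_ + _).
  rewrite p1E sum_periodic => [|i]; last first.
    apply/eqP; rewrite X_eq exprD exprMn -(exprM _ n) -p1E.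
    by rewrite (prim_expr_order g_prim) mulr1.
  by rewrite scaler_nat; congr (_ *+ _); apply: eq_big_nat => -[].
split; first exists chi.
  split=> // [i _|i j le_in le_jn ne_ij /chi_inj chi_ij]; first exact: X_irr.
  exact/ne_ij/chi_ij.
pose m i := if i is 0%N then 1%N else 3%N.
have -> : ((p + 2) %/ 3)%N = n.+1.
  have p_gt0 := prime_gt0 p_prime.
  rewrite -(prednK p_gt0) p1E addSn -addnS -[3%N]mul1n -mulnDl.
  by rewrite mulnK // addn1.
have -> : 'Ind[groupG p] lambda = \sum_(0 <= i < n.+1) (m i)%:R *: chi i.
  rewrite indE [RHS]big_ltn // scale1r scaler_sumr; congr (_ + _).
  by apply: eq_big_nat => -[].
apply: eta_constt_sum => [i _|i j|[|i]] //; first exact: X_irr.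
exact: chi_inj.
Qed.
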